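(* Let $K_n=(V,\sigma,\mu)$ be a complete fuzzy graph with $n$ vertices, all of positive membership value. Then $$\gamma_{snR}(K_n)=2\min\{\mu_s(v):v\in V\}.$$
   Context: A fuzzy graph $G=(V,\sigma,\mu)$ consists of a finite nonempty set $V$, a function $\sigma:V\to[0,1]$, and a symmetric function $\mu:V\times V\to[0,1]$ with $\mu(x,x)=0$ and $\mu(x,y)\le \min\{\sigma(x),\sigma(y)\}$ for all $x,y\in V$. It is complete, denoted $K_n$, if $\mu(u,v)=\min\{\sigma(u),\sigma(v)\}$ for all distinct $u,v\in V$, where $V=\sigma^*=\{u\in V:\sigma(u)>0\}$ has $n$ elements. An edge is an unordered pair $(u,v)$ of distinct vertices with $\mu(u,v)>0$, and $\mu(u,v)$ is its weight. The strength of a path $x_0,x_1,\ldots,x_m$ (with every $\mu(x_{i-1},x_i)>0$) is $\min_i \mu(x_{i-1},x_i)$, and $CONN_G(u,v)$ is the maximum strength of all $u$–$v$ paths. An edge $(u,v)$ is strong if $\mu(u,v)=CONN_G(u,v)$; then $u,v$ are strong neighbors. $N_s(u)$ is the set of strong neighbors of $u$. Put $\mu_s(u)=\min\{\mu(u,v):v\in N_s(u)\}$, with $\mu_s(u)=0$ if $N_s(u)=\emptyset$. A strong-neighbors Roman dominating function (SNRDF) on $G$ is a function $f:V\to\{0,1,2\}$ such that every $u$ with $f(u)=0$ has some $v\in N_s(u)$ with $f(v)=2$. Its weight is $w(f)=\sum_{u\in V}f(u)\mu_s(u)$, and $\gamma_{snR}(G)$ is the minimum weight of an SNRDF on $G$.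 *)

(* Defs.v *)
From mathcomp Require Import all_boot all_order all_algebra.
From mathcomp Require Import reals.

Set Implicit Arguments.
Unset Strict Implicit.
Unset Printing Implicit Defensive.

Import Order.TTheory GRing.Theory Num.Theory.
Local Open Scope ring_scope.

(* The minimum of F over the elements of T satisfying P; by convention it is 0
   when there are none, which is also the convention used for mu_s. *)
Definition fmin (R : realType) (T : finType) (P : pred T) (F : T -> R) : R :=
  if [pick x | P x] is Some x0 then F [arg min_(x < x0 | P x) F x]%O else 0.

Lemma fmin_spec (R : realType) (T : finType) (P : pred T) (F : T -> R) :
  (exists x, P x) ->
  (exists2 x, P x & fmin P F = F x) /\ (forall x, P x -> fmin P F <= F x).
Proof.
rewrite /fmin => -[y Py]; case: pickP => [x0 Px0 | /(_ y)]; last by rewrite Py.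
by case: arg_minP => // x Px xmin; split=> //; exists x.
Qed.

Lemma fmin_empty (R : realType) (T : finType) (P : pred T) (F : T -> R) :
  P =1 pred0 -> fmin P F = 0.
Proof. by rewrite /fmin => P0; case: pickP => // x; rewrite P0. Qed.

Record fuzzyGraph (R : realType) (V : finType) := FuzzyGraph {
  sigma : V -> R;
  mu : V -> V -> R;
  vertices_nonempty : (0 < #|V|)%N;
  sigma_bounds : forall x, 0 <= sigma x <= 1;
  mu_bounds : forall x y, 0 <= mu x y <= 1;
  mu_sym : forall x y, mu x y = mu y x;
  mu_irr : forall x, mu x x = 0;
  mu_le_min : forall x y, mu x y <= Num.min (sigma x) (sigma y)
}.

Section FuzzyGraphs.
Variables (R : realType) (V : finType) (G : fuzzyGraph R V).
Implicit Types (u v : V) (p : seq V) (f : {ffun V -> 'I_3}).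

Definition support : {set V} := [set u | 0 < sigma G u].

Definition complete_fuzzy_graph (n : nat) : Prop :=
  [/\ [set: V] = support, #|support| = n
    & forall u v, u != v -> mu G u v = Num.min (sigma G u) (sigma G v)].

Definition fuzzy_edge : rel V := fun u v => (u != v) && (0 < mu G u v).

(* The path x_0, ..., x_m is encoded by its origin u = x_0 and the sequence
   p = [:: x_1; ...; x_m]; its vertices are pairwise distinct. *)
Definition fuzzy_path u v p : bool :=
  [&& path fuzzy_edge u p, uniq (u :: p) & last u p == v].

(* The initial value 1 is neutral, since all weights are at most 1. *)
Definition strength u p : R := \big[Num.min/1]_(w <- pairmap (mu G) u p) w.

(* A path has m < #|V| edges; the initial value 0 is neutral, since strengths
   are nonnegative, and is the value when no path from u to v exists. *)
Definition CONN u v : R :=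
  \big[Num.max/0]_(m < #|V|)
    \big[Num.max/0]_(p : m.-tuple V | fuzzy_path u v p) strength u p.

Definition strong_edge u v : bool := fuzzy_edge u v && (mu G u v == CONN u v).

Definition strong_neighbors u : {set V} := [set v | strong_edge u v].

Definition mu_s u : R := fmin (mem (strong_neighbors u)) (mu G u).

Definition SNRDF f : bool :=
  [forall u, (f u == 0%N :> nat) ==>
    [exists v in strong_neighbors u, f v == 2%N :> nat]].

Definition snR_weight f : R := \sum_(u : V) (f u)%:R * mu_s u.

Definition gamma_snR : R := fmin SNRDF snR_weight.

Lemma SNRDF_exists : exists f, SNRDF f.
Proof.
by exists [ffun=> ord_max]; apply/forallP => u; rewrite ffunE.
Qed.

End FuzzyGraphs.

(* Main.v *)
Require Import Defs.
From mathcomp Require Import all_boot all_order all_algebra.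
From mathcomp Require Import reals.

(* In a complete fuzzy graph every path from u to v starts with an edge of
   weight at most sigma u and ends with one of weight at most sigma v, so every
   edge is strong. Hence, with at least two vertices, mu_s is constant, equal
   to the least value of sigma, and the weight of an SNRDF f is this constant
   times the sum of the values of f. That sum is at least 2, and it equals 2
   when f is 2 at one vertex and 0 elsewhere. *)

Set Implicit Arguments.
Unset Strict Implicit.
Unset Printing Implicit Defensive.

Import Order.TTheory GRing.Theory Num.Theory.
Local Open Scope ring_scope.

Lemma fmin_eq (R : realType) (T : finType) (P : pred T) (F : T -> R) x :
  P x -> (forall y, P y -> F x <= F y) -> fmin P F = F x.
Proof.
move=> Px xmin; have [|[y Py Fy] ymin] := @fmin_spec R T P F; first by exists x.
by apply/eqP; rewrite eq_le ymin //= Fy xmin.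
Qed.

Section FuzzyGraph.
Variables (R : realType) (V : finType) (G : fuzzyGraph R V).
Implicit Types (u v x : V) (p : seq V).

Lemma mu_le_sigmal u v : mu G u v <= sigma G u.
Proof. by have := mu_le_min G u v; rewrite le_min => /andP[]. Qed.

Lemma mu_le_sigmar u v : mu G u v <= sigma G v.
Proof. by rewrite mu_sym mu_le_sigmal. Qed.

Lemma strength_cons u x p :
  strength G u (x :: p) = Num.min (mu G u x) (strength G x p).
Proof. by rewrite /strength /= big_cons. Qed.

(** The path is taken with at least one edge because the empty one has strength 1, which may exceed
    [sigma]. *)
Lemma strength_le_sigma_head u x p : strength G u (x :: p) <= sigma G u.
Proof. by rewrite strength_cons ge_min mu_le_sigmal. Qed.

Lemma strength_le_sigma_last u x p :
  strength G u (x :: p) <= sigma G (last x p).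
Proof.
elim: p u x => [|y p IHp] u x; rewrite strength_cons ge_min.
  by rewrite mu_le_sigmar.
by rewrite [X in _ || X]IHp orbT.
Qed.

Lemma CONN_le_sigma u v :
  u != v -> CONN G u v <= Num.min (sigma G u) (sigma G v).
Proof.
(* Both maxima in [CONN] start from 0, so the bound must itself be nonnegative. *)
move=> neq_uv; have min_ge0 : 0 <= Num.min (sigma G u) (sigma G v).
  by rewrite le_min; case/andP: (sigma_bounds G u) (sigma_bounds G v) => -> _ /andP[].
apply: bigmax_le => // m _; apply: bigmax_le => // p /and3P[_ _].
case: (tval p) => [|x q] /= /eqP last_v; first by rewrite last_v eqxx in neq_uv.
by rewrite le_min strength_le_sigma_head -last_v strength_le_sigma_last.
Qed.

Lemma mu_le_CONN u v : fuzzy_edge G u v -> mu G u v <= CONN G u v.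
Proof.
move=> e_uv; have /andP[neq_uv _] := e_uv.
(* The edge itself is a path of length 1, and this length is in the range of [CONN] only if 1 is
   below [#|V|]. *)
have lt1V : (1 < #|V|)%N.
  by rewrite cardE (@uniq_leq_size _ [:: u; v]) //= ?inE ?neq_uv // => x; rewrite mem_enum.
apply: (le_trans _ (le_bigmax _ _ (Ordinal lt1V))) => /=.
apply: (le_trans _ (le_bigmax_cond (j := [tuple v]) _ _ _)).
  rewrite strength_cons /strength big_nil le_min lexx /=.
  by case/andP: (mu_bounds G u v).
by rewrite /fuzzy_path /= e_uv inE neq_uv eqxx.
Qed.

(** A vertex of value 0 forces a neighbor of value 2; without such a vertex, at least two vertices
    contribute 1 or more each. *)
Lemma sum_SNRDF_ge2 (f : {ffun V -> 'I_3}) :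
  (1 < #|V|)%N -> SNRDF G f -> (2 <= \sum_u f u)%N.
Proof.
move=> lt1V /forallP f_dom.
have [u fu0|f_neq0] := pickP (fun u => f u == 0%N :> nat).
  have /existsP[v /andP[_ /eqP fv]] := implyP (f_dom u) fu0.
  by rewrite (bigD1 v) //= fv.
apply: (leq_trans lt1V); rewrite -sum1_card.
by apply: leq_sum => u _; rewrite lt0n f_neq0.
Qed.

Lemma snR_weight_const (c : R) (f : {ffun V -> 'I_3}) :
  (forall u, mu_s G u = c) -> snR_weight G f = (\sum_u f u)%N%:R * c.
Proof.
by move=> mu_sc; rewrite natr_sum mulr_suml; apply: eq_bigr => u _; rewrite mu_sc.
Qed.

Section Complete.
Variables (n : nat) (hG : complete_fuzzy_graph G n).

Lemma complete_strong_edge u v : strong_edge G u v = (u != v).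
Proof.
have [V_supp _ mu_min] := hG.
have sigma_gt0 x : 0 < sigma G x.
  by have := in_setT x; rewrite V_supp inE.
apply/idP/idP => [/andP[/andP[]] // | neq_uv].
have e_uv : fuzzy_edge G u v by rewrite /fuzzy_edge neq_uv mu_min ?lt_min ?sigma_gt0.
by rewrite /strong_edge e_uv eq_le mu_le_CONN //= mu_min // CONN_le_sigma.
Qed.

Lemma complete_mu_s u w :
  (1 < #|V|)%N -> (forall v, sigma G w <= sigma G v) -> mu_s G u = sigma G w.
Proof.
move=> lt1V w_min; have [_ _ mu_min] := hG.
(* If [u] is [w], any other vertex serves as [v]; otherwise [w] does. *)
have [v neq_uv mu_uv] : exists2 v, u != v & mu G u v <= sigma G w.
  have [<-|neq_uw] := eqVneq u w; last by exists w; rewrite ?mu_le_sigmar.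
  have /card_gt0P[v] : (0 < #|predC1 u|)%N by rewrite cardC1; case: #|V| lt1V => [|[]].
  by rewrite !inE eq_sym => neq_uv; exists v; rewrite ?mu_le_sigmal.
have mu_ge x : u != x -> sigma G w <= mu G u x.
  by move=> neq_ux; rewrite mu_min // le_min !w_min.
have mu_uvE : mu G u v = sigma G w by apply/eqP; rewrite eq_le mu_uv mu_ge.
rewrite -mu_uvE; apply: fmin_eq; first by rewrite /= inE complete_strong_edge.
by move=> x; rewrite /= inE complete_strong_edge mu_uvE; apply: mu_ge.
Qed.

(** A lone vertex has no strong neighbor, so [fmin] returns its default value. *)
Lemma complete_mu_s_le1 u : (#|V| <= 1)%N -> mu_s G u = 0.
Proof.
move=> V1; apply: fmin_empty => v; rewrite /= inE complete_strong_edge.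
by rewrite (fintype_le1P V1 u v) eqxx.
Qed.

Lemma complete_point_SNRDF w :
  SNRDF G [ffun u => if u == w then ord_max else ord0].
Proof.
apply/forallP => u; rewrite ffunE; have [//|neq_uw /=] := eqVneq u w.
by apply/existsP; exists w; rewrite inE complete_strong_edge neq_uw ffunE eqxx.
Qed.

End Complete.
End FuzzyGraph.

Theorem corollary3p8 (R : realType) (V : finType) (G : fuzzyGraph R V) (n : nat)
  (hG : complete_fuzzy_graph G n) :
  gamma_snR G = 2 * fmin predT (mu_s G).
Proof.
have /card_gt0P[u0 _] := vertices_nonempty G.
have [w _ w_min] := @arg_minP _ _ _ u0 predT (sigma G) isT.
(* The constant is 0 for a single vertex and [sigma G w] otherwise. *)
have [c mu_sc c_cond] : exists2 c : R, forall u, mu_s G u = c &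
    c = 0 \/ (0 <= c /\ (1 < #|V|)%N).
  have [V1|lt1V] := leqP #|V| 1.
    by exists 0; [move=> u; apply: complete_mu_s_le1 hG _ V1 | left].
  exists (sigma G w); last by right; case/andP: (sigma_bounds G w).
  by move=> u; apply: (complete_mu_s hG) => // v; apply: w_min.
rewrite (@fmin_eq _ _ predT (mu_s G) w) // => [|v _]; last by rewrite !mu_sc.
pose f := [ffun u : V => if u == w then ord_max else ord0 : 'I_3].
have sum_f : (\sum_u f u)%N = 2%N.
  rewrite (bigD1 w) //= big1 ?ffunE ?eqxx // => u /negPf neq_uw.
  by rewrite ffunE neq_uw.
(* The right-hand side becomes the weight of [f], so it remains to show that [f] is a minimizer. *)
rewrite mu_sc -[2]/(2%:R) -sum_f -(snR_weight_const f mu_sc).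
apply: fmin_eq => [|g g_dom]; first exact: complete_point_SNRDF hG w.
rewrite !(snR_weight_const _ mu_sc) sum_f.
(* On a single vertex the sum of values can be 1, but all weights vanish there. *)
case: c_cond => [->|[c_ge0 lt1V]]; first by rewrite !mulr0.
by rewrite ler_wpM2r // ler_nat (sum_SNRDF_ge2 lt1V g_dom).
Qed.
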